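(* Let $d\in\mathbb{N}$ be fixed. Assume that $\zeta\in L^2([0,1]\times[0,1])$, that $\lambda_d>0$, and that the following hold as $n\to\infty$: (L) for all $x\in\mathbb{R}$, $\lim_{n\to\infty}P\big(a(\log n)\,T_n(Y;v,\lambda)-b_d(\log n)\le x\big)=\exp(-2\exp(-x))$; (P2) $\big\|\sum_{i=1}^nY_i\big\|=o_P(n)$; (B1) under $H_A$, $\hat\lambda_1=o_P\big(n/(\log\log n)\big)$; (B2) under $H_A$, $\big|\int\Delta(t)\hat v_r(t)\,dt\big|\xrightarrow{P}\xi$ for some $1\le r\le d$ and some constant $\xi>0$. Then under $H_A$, as $n\to\infty$, $$(\log\log n)^{-1/2}\,\hat T_n\xrightarrow{P}\infty.$$
   Context: All function spaces are real; $\|\cdot\|$ is the norm of $L^2[0,1]$; $\int=\int_0^1$. Model. $\{Y_i\}_{i\in\mathbb{Z}}$ are $L^2[0,1]$-valued random elements on a probability space $(\Omega,\mathcal{A},P)$, product measurable in $(t,\omega)$. Standing assumption: $\{Y_i\}$ is centered and strictly stationary with $E\|Y_1\|^\nu<\infty$ for some $\nu>2$. The observations are $X_i(t)=\mu_i(t)+Y_i(t)$, $t\in[0,1]$, $i=1,\dots,n$, with deterministic $\mu_i\in L^2[0,1]$. The alternative is $H_A:\ \mu_1=\dots=\mu_{\lfloor n\theta\rfloor}\ne\mu_{\lfloor n\theta\rfloor+1}=\dots=\mu_n$ for some constant $\theta\in(0,1)$; the change is $\Delta(t)=\mu_n(t)-\mu_1(t)$, a fixed function (not depending on $n$) with $\Delta\ne0$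 in $L^2[0,1]$. Long run covariance. $\zeta(t,s)=\sum_{r\in\mathbb{Z}}E[Y_0(t)Y_r(s)]$ (convergence in $L^2([0,1]\times[0,1])$), and $(\mathcal{C}x)(t)=\int\zeta(t,s)x(s)\,ds$. When $\zeta\in L^2([0,1]\times[0,1])$, $\mathcal{C}$ is a symmetric positive Hilbert–Schmidt operator with eigenvalues $\lambda_1\ge\lambda_2\ge\dots\ge0$ and corresponding orthonormal eigenfunctions $v_1,v_2,\dots$. Statistics. For a sequence of functions $Z=\{Z_i\}$ (with $\bar Z_n=n^{-1}\sum_{i=1}^nZ_i$), orthonormal functions $u=\{u_i\}$ and non-negative scalars $\ell=\{\ell_i\}$, put $$\eta_{k,r}(Z;u)=n^{-1/2}\int\sum_{i=1}^k[Z_i(t)-\bar Z_n(t)]u_r(t)\,dt,$$ $$T_n(Z;u,\ell)=\max_{1\le k<n}w(k/n)\Big(\frac{\eta_{k,1}^2(Z;u)}{\ell_1}+\dots+\frac{\eta_{k,d}^2(Z;u)}{\ell_d}\Big)^{1/2},\qquad w(t)=(t(1-t))^{-1/2},$$ with the convention $T_n=\infty$ if $\ell_r=0$ for some $1\le r\le d$. The estimated statistic is $\hat T_n=T_n(X;\hat v,\hat\lambda)$, where $\{\hat v_i\}$ are random orthonormal functions and $\hat\lambda_1\ge\hat\lambda_2\ge\dots\ge0$ are random scalars (both depending on $n$), serving as generic estimates of $\{v_i\}$ and $\{\lambda_i\}$. Normalizing functions. $a(t)=(2\log t)^{1/2}$ and $b_d(t)=2\log t+(d/2)\log\log t-\log\Gamma(d/2)$.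 *)

(* Defs.v *)
From HB Require Import structures.
From mathcomp Require Import all_boot all_order all_algebra.
From mathcomp Require Import all_classical all_reals all_analysis.

Set Implicit Arguments.
Unset Strict Implicit.
Unset Printing Implicit Defensive.

Import Order.TTheory GRing.Theory Num.Theory.
Import numFieldNormedType.Exports.

Local Open Scope classical_set_scope.
Local Open Scope ring_scope.

(* A function on [0,1] is represented by a function R -> R; since every
   integral, norm and a.e. equality is taken with respect to Lebesgue measure
   restricted to [0,1], its values outside [0,1] are irrelevant. *)
Section L2_unit_interval.
Context {R : realType}.

Definition leb01 : set (measurableTypeR R) -> \bar R :=
  mrestr lebesgue_measure (measurable_itv `[0, 1]).

HB.instance Definition _ := Measure.copy leb01
  (mrestr lebesgue_measure (measurable_itv `[0, 1])).

Lemma leb01_fin : fin_num_fun leb01.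
Proof.
apply: lty_fin_num_fun.
by rewrite /= /leb01 /mrestr setTI lebesgue_measure_itv /= lte_fin ltr01
  oppr0 adde0 ltry.
Qed.

HB.instance Definition _ := Measure_isFinite.Build _ _ _ leb01 leb01_fin.

Definition L2 (f : R -> R) : Prop := f \in Lfun leb01 2%:E.

Definition L2sq (f : R * R -> R) : Prop := f \in Lfun (leb01 \x leb01)%E 2%:E.

Definition l2norm (f : R -> R) : R := fine 'N[leb01]_2%:E[EFin \o f]%E.

Definition l2dot (f g : R -> R) : R := \int[leb01]_t (f t * g t).

Definition orthonormal2 (u : nat -> R -> R) : Prop :=
  (forall i, L2 (u i)) /\ forall i j, l2dot (u i) (u j) = (i == j)%:R.

(* Open sets of L^2[0,1]^m for the product topology, as sets of m-tuples of
   representatives; what such a set contains outside L^2 is irrelevant. *)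
Definition L2open m (U : set ('I_m -> R -> R)) : Prop :=
  forall f, U f -> (forall j, L2 (f j)) ->
  exists2 e : R, 0 < e &
    forall g, (forall j, L2 (g j)) ->
      (forall j, l2norm (f j \- g j) < e) -> U g.

Definition L2borel m : set (set ('I_m -> R -> R)) := <<s @L2open m >>.

End L2_unit_interval.

Section random_functions.
Context {R : realType} {disp : measure_display} {T : measurableType disp}.

Definition random_L2 (Z : T -> R -> R) : Prop :=
  measurable_fun [set: measurableTypeR R * T]
    (fun p : measurableTypeR R * T => Z p.2 p.1) /\
  forall w, L2 (Z w).

Variable P : probability T R.

Definition strictly_stationary (Y : int -> T -> R -> R) : Prop :=
  forall m (s : 'I_m -> int) (h : int) (B : set ('I_m -> R -> R)),
    L2borel B ->
    P [set w | B (fun j => Y (s j + h) w)] = P [set w | B (fun j => Y (s j) w)].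

Definition centered (Y : int -> T -> R -> R) : Prop :=
  forall i, {ae leb01, forall t, 'E_P[fun w => Y i w t] = 0}%E.

(* The product is integrable, so that [fine] is harmless, for almost every
   (t, s) in the unit square as soon as E||Y_i||^2 is finite. *)
Definition crosscov (Y : int -> T -> R -> R) (r : int) (t s : R) : R :=
  fine ('E_P[fun w => (Y 0 w t * Y r w s)%R])%E.

Definition crosscov_sum (Y : int -> T -> R -> R) (m n : nat) (x : R * R) : R :=
  \sum_(0 <= k < (m + n).+1) crosscov Y (k%:Z - m%:Z) x.1 x.2.

(* The bilateral series over r is the limit of the sums over -m <= r <= n as
   m and n tend to infinity independently. *)
Definition is_long_run_cov (Y : int -> T -> R -> R) (zeta : R * R -> R)
    : Prop :=
  'N[leb01 \x leb01]_2%:E[EFin \o (crosscov_sum Y mn.1 mn.2 \- zeta)%R]%E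
    @[mn --> filter_prod \oo \oo] --> 0%E.

Definition cvg_prob (Z : nat -> T -> R) (c : R) : Prop :=
  forall e : R, 0 < e -> P [set w | e < `|Z n w - c|] @[n --> \oo] --> 0%E.

Definition cvg_prob_pinfty (Z : nat -> T -> \bar R) : Prop :=
  forall M : R, P [set w | (M%:E < Z n w)%E] @[n --> \oo] --> 1%E.

Definition little_oP (Z : nat -> T -> R) (a : nat -> R) : Prop :=
  cvg_prob (fun n w => Z n w / a n) 0.

End random_functions.

Section spectrum.
Context {R : realType}.

Definition integral_op (zeta : R * R -> R) (x : R -> R) (t : R) : R :=
  \int[leb01]_s (zeta (t, s) * x s).

(* [lambda] and [v] are indexed from 0.  The last clause says that the list
   [lambda] is exhaustive: every nonzero eigenvalue occurs in it as many times
   as its multiplicity. *)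
Definition eigen_system (zeta : R * R -> R) (lambda : nat -> R)
    (v : nat -> R -> R) : Prop :=
  [/\ orthonormal2 v,
      forall k, 0 <= lambda k.+1 <= lambda k,
      forall k, {ae leb01, forall t, integral_op zeta (v k) t
                                     = lambda k * v k t} &
      forall (kappa : R) (x : R -> R), kappa != 0 -> L2 x ->
        {ae leb01, forall t, integral_op zeta x t = kappa * x t} ->
        (forall k, l2dot x (v k) = 0) ->
        {ae leb01, forall t, x t = 0}].

End spectrum.

Section statistic.
Context {R : realType}.

(* [Z i], 1 <= i <= n, are the data; the directions [u] and the scalings [l]
   are indexed from 0. *)
Definition sample_mean (n : nat) (Z : nat -> R -> R) (t : R) : R :=
  n%:R^-1 * \sum_(1 <= i < n.+1) Z i t.

Definition eta (n k r : nat) (Z u : nat -> R -> R) : R :=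
  (Num.sqrt n%:R)^-1 *
  \int[leb01]_t ((\sum_(1 <= i < k.+1) (Z i t - sample_mean n Z t)) * u r t).

Definition weight (t : R) : R := (Num.sqrt (t * (1 - t)))^-1.

Definition Tstat (d n : nat) (Z u : nat -> R -> R) (l : nat -> R) : \bar R :=
  if [exists r : 'I_d, l r == 0] then +oo%E
  else (\big[Num.max/0]_(1 <= k < n)
          (weight (k%:R / n%:R) *
           Num.sqrt (\sum_(r < d) eta n k r Z u ^+ 2 / l r)))%:E.

Definition Gamma (x : R) : R :=
  \int[lebesgue_measure]_(t in `]0, +oo[) (t `^ (x - 1) * expR (- t)).

Definition a_norm (t : R) : R := Num.sqrt (2 * ln t).

Definition b_norm (d : nat) (t : R) : R :=
  2 * ln t + d%:R / 2 * ln (ln t) - ln (Gamma (d%:R / 2)).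

(* [mu n i], 1 <= i <= n, are the means of the sample of size [n]; the
   condition on [n] excludes the finitely many sample sizes for which no
   observation precedes the change. *)
Definition H_A (theta : R) (Delta : R -> R) (mu : nat -> nat -> R -> R)
    : Prop :=
  [/\ 0 < theta < 1,
      L2 Delta, ~ {ae leb01, forall t, Delta t = 0},
      forall n i, L2 (mu n i) &
      forall n, (0 < Num.truncn (n%:R * theta))%N ->
        [/\ forall i, (1 <= i <= Num.truncn (n%:R * theta))%N ->
              {ae leb01, forall t, mu n i t = mu n 1%N t},
            forall i, (Num.truncn (n%:R * theta) < i <= n)%N ->
              {ae leb01, forall t, mu n i t = mu n n t} &
            {ae leb01, forall t, mu n n t - mu n 1%N t = Delta t}]].

Definition observation {T : Type} (mu : nat -> nat -> R -> R)
    (Y : int -> T -> R -> R) (n i : nat) (w : T) (t : R) : R :=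
  mu n i t + Y i%:Z w t.

End statistic.

(* Main.v *)
Require Import Defs.
From HB Require Import structures.
From mathcomp Require Import all_boot all_order all_algebra.
From mathcomp Require Import all_classical all_reals all_analysis.
From mathcomp Require Import measurable_realfun ring lra.

Set Implicit Arguments.
Unset Strict Implicit.
Unset Printing Implicit Defensive.

Import Order.TTheory GRing.Theory Num.Theory.
Import numFieldNormedType.Exports.

Local Open Scope classical_set_scope.
Local Open Scope ring_scope.

(** The maximum defining the statistic is bounded below by its term at the time
    of change [k = floor (n theta)], and in that term by the coordinate [r] on
    which the estimated direction is not asymptotically orthogonal to the
    change [Delta].  There the centered partial sum of the observations is
    - a drift, which is almost everywhere
      [- (k (n - k) / n) Delta] ([cusum_step], [l2dot_cusum_step]), so that its
      coordinate is of exact order [n], plus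
    - the centered partial sum of the errors, whose coordinate on any unit
      vector is at most [||S_k|| + (k / n) ||S_n||] by Cauchy-Schwarz
      ([ler_norm_l2dot_cusum]).
    The assumption [||S_n|| = o_P(n)] bounds both noise terms: it is applied
    along [n] for the second, and along the deterministic subsequence
    [floor (n theta)], which tends to infinity, for the first.  Hence [eta ^ 2]
    is at least a positive constant times [n], whereas its scaling is at most
    [lambdah 0 = o_P(n / log log n)]; the quotient exceeds any multiple of
    [log log n] ([sqr_drift_gt], [Tstat_gt]).

    These bounds hold outside the union of four events whose probabilities tend
    to zero.  Monotonicity and subadditivity of [P] are available on
    measurable sets only, so the norms, inner products and the statistic itself
    have to be measurable functions of the outcome; this follows from the joint
    measurability of the random functions through the Fubini-Tonelli theorem
    ([measurable_Rintegral_leb01], [measurable_Tstat]). *)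

(** * Inner product and norm of L2[0,1] *)

(** Lets the filter lemmas combine almost-everywhere statements for [leb01]. *)
#[local] Instance ae_leb01_filter (R : realType) :
  Filter (nbhs (almost_everywhere (@leb01 R))).
Proof. exact: ae_filter_ringOfSetsType. Qed.

Section L2_geometry.
Context {R : realType}.
Implicit Types f g u : R -> R.

(** Both sides are the default value [0] when the integral of [f ^ 2] is
    infinite.  Through this form the measurability of norms reduces to that of
    inner products. *)
Lemma l2normE f : l2norm f = Num.sqrt (l2dot f f).
Proof.
rewrite /l2norm /l2dot unlock /Rintegral.
have -> : (\int[leb01]_x (`|(EFin \o f) x| `^ 2) =
           \int[leb01]_x (f x * f x)%:E :> \bar R)%E.
  apply: eq_integral => x _ /=.
  by rewrite powR_mulrn// real_normK ?num_real.
rewrite poweR12_sqrt; last first.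
  by apply: integral_ge0 => x _; rewrite lee_fin -expr2 sqr_ge0.
by case: (\int[leb01]_x _)%E => [r| |] //=; rewrite sqrtr0.
Qed.

Lemma L2_measurable f : L2 f ->
  measurable_fun [set: measurableTypeR R] (f : measurableTypeR R -> R).
Proof. by move=> /sub_Lfun_mfun; rewrite inE. Qed.

Lemma L2D f g : L2 f -> L2 g -> L2 (fun t => f t + g t).
Proof.
move=> Lf Lg.
have p1 : (1 <= (2%:E : \bar R))%E by rewrite lee_fin ler1n.
exact: (Lfun_addr_closed leb01 p1).2.
Qed.

Lemma L2Z (a : R) f : L2 f -> L2 (fun t => a * f t).
Proof.
move=> Lf.
rewrite (_ : (fun t => a * f t) = a \o* f); last first.
  by apply/funext => t /=; rewrite mulrC.
by apply: Lfun_scale => //; rewrite ler1n.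
Qed.

Lemma L2_sum I (s : seq I) (f : I -> R -> R) : (forall i, L2 (f i)) ->
  L2 (fun t => \sum_(i <- s) f i t).
Proof.
move=> Lf; elim: s => [|i s IHs].
  by under eq_fun do rewrite big_nil; exact: Lfun_cst.
under eq_fun do rewrite big_cons.
exact: L2D.
Qed.

Lemma L2M_integrable f g : L2 f -> L2 g ->
  leb01.-integrable setT (EFin \o (fun t => f t * g t)).
Proof. by move=> Lf Lg; apply/Lfun1_integrable; exact: Lfun2_mul_Lfun1. Qed.

Lemma l2dotDl f g u : L2 f -> L2 g -> L2 u ->
  l2dot (fun t => f t + g t) u = l2dot f u + l2dot g u.
Proof.
move=> Lf Lg Lu; rewrite /l2dot -RintegralD//;
  [|exact: L2M_integrable|exact: L2M_integrable].
by apply: eq_Rintegral => t _; rewrite mulrDl.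
Qed.

Lemma l2dotZl (a : R) f u : L2 f -> L2 u ->
  l2dot (fun t => a * f t) u = a * l2dot f u.
Proof.
move=> Lf Lu; rewrite /l2dot -RintegralZl//; last exact: L2M_integrable.
by apply: eq_Rintegral => t _; rewrite mulrA.
Qed.

(** The hypotheses on the means are equalities almost everywhere; this lemma
    lets them enter inner products. *)
Lemma ae_eq_l2dotl f g u : L2 f -> L2 g -> L2 u ->
  {ae leb01, forall t, f t = g t} -> l2dot f u = l2dot g u.
Proof.
move=> Lf Lg Lu fg; rewrite /l2dot /Rintegral; congr fine.
apply: ae_eq_integral => //.
- exact: measurable_int (L2M_integrable Lf Lu).
- exact: measurable_int (L2M_integrable Lg Lu).
- by apply: filterS fg => t /= -> _.
Qed.

(** Cauchy-Schwarz, as the case [p = q = 2] of Hoelder's inequality. *)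
Lemma ler_norm_l2dot f u : L2 f -> L2 u ->
  `|l2dot f u| <= l2norm f * l2norm u.
Proof.
move=> Lf Lu.
have fin g : L2 g -> (l2norm g)%:E = 'N[leb01]_2%:E[EFin \o g]%E.
  move=> Lg; rewrite fineK// ge0_fin_numE ?Lnorm_ge0//.
  by move/sub_Lfun_finLfun: Lg; rewrite inE.
have iM := L2M_integrable Lf Lu.
rewrite -lee_fin EFinM !fin//.
rewrite (EFin_normr_Rintegral measurableT iM).
apply: le_trans (le_abse_integral _ measurableT (measurable_int _ iM)) _.
rewrite -Lnorm1.
by apply: hoelder => //; [exact: L2_measurable|exact: L2_measurable|lra].
Qed.

End L2_geometry.

(** * Centered partial sums and their drift *)

Definition psum {R : realType} (Z : nat -> R -> R) (k : nat) (t : R) : R :=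
  \sum_(1 <= i < k.+1) Z i t.

(** The integrand of [eta]: the partial sum of the centered data, arranged so
    that linearity in the data is visible. *)
Definition cusum {R : realType} (n k : nat) (Z : nat -> R -> R) (t : R) : R :=
  psum Z k t + - (k%:R / n%:R) * psum Z n t.

Section cusum_theory.
Context {R : realType}.
Implicit Types (Z mu : nat -> R -> R) (u Delta : R -> R).

Lemma L2_psum Z k : (forall i, L2 (Z i)) -> L2 (psum Z k).
Proof. exact: L2_sum. Qed.

Lemma L2_cusum n k Z : (forall i, L2 (Z i)) -> L2 (cusum n k Z).
Proof. by move=> LZ; apply: L2D; [|apply: L2Z]; exact: L2_psum. Qed.

Lemma etaE n k r Z (u : nat -> R -> R) :
  Defs.eta n k r Z u = (Num.sqrt n%:R)^-1 * l2dot (cusum n k Z) (u r).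
Proof.
rewrite /Defs.eta /l2dot; congr (_ * _); apply: eq_Rintegral => t _.
congr (_ * _); rewrite sumrB sumr_const_nat subn1 /= /cusum /psum /sample_mean.
by rewrite -[_ *+ k]mulr_natl mulNr mulrA.
Qed.

Lemma cusumD n k Z Z' :
  cusum n k (fun i t => Z i t + Z' i t) =
  (fun t => cusum n k Z t + cusum n k Z' t).
Proof.
by apply/funext => t; rewrite /cusum /psum !big_split /=; ring.
Qed.

Lemma ler_norm_l2dot_cusum n k Z u : (forall i, L2 (Z i)) -> L2 u ->
    l2norm u = 1 ->
  `|l2dot (cusum n k Z) u| <=
  l2norm (psum Z k) + k%:R / n%:R * l2norm (psum Z n).
Proof.
move=> LZ Lu u1.
have LS j := L2_psum j LZ.
rewrite /cusum l2dotDl//; last exact: L2Z.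
rewrite l2dotZl//.
apply: le_trans (ler_normD _ _) _; apply: lerD.
  by rewrite -[leRHS]mulr1 -u1; exact: ler_norm_l2dot.
rewrite normrM normrN [`|_ / _|]ger0_norm ?divr_ge0//.
rewrite ler_wpM2l ?divr_ge0//.
by rewrite -[leRHS]mulr1 -u1; exact: ler_norm_l2dot.
Qed.

(** With [k] terms equal to [a] and [n - k] equal to [b], the mean is
    [(k a + (n - k) b) / n], and each of the first [k] terms deviates from it by
    [- (n - k) (b - a) / n]. *)
Lemma cusum_step mu n k (a b t : R) : (0 < k <= n)%N ->
    (forall i, (1 <= i <= k)%N -> mu i t = a) ->
    (forall i, (k < i <= n)%N -> mu i t = b) ->
  cusum n k mu t = - (k%:R * (n%:R - k%:R) / n%:R) * (b - a).
Proof.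
move=> /andP[k0 kn] ma mb.
have Sk : psum mu k t = k%:R * a.
  rewrite /psum (eq_big_nat _ _ (F2 := fun=> a)); last first.
    by move=> i /andP[i1 ik]; apply: ma; rewrite i1.
  by rewrite sumr_const_nat subn1 mulr_natl.
have Sn : psum mu n t = k%:R * a + (n%:R - k%:R) * b.
  rewrite /psum (big_cat_nat (n := k.+1))//=; congr (_ + _); first exact: Sk.
  rewrite (eq_big_nat _ _ (F2 := fun=> b)); last first.
    by move=> i /andP[i1 ik]; apply: mb; rewrite i1.
  by rewrite sumr_const_nat subSS -[_ *+ (_ - _)]mulr_natl natrB.
have n0 : n%:R != 0 :> R by rewrite pnatr_eq0 -lt0n (leq_trans k0).
by rewrite /cusum Sk Sn; field.
Qed.

Lemma l2dot_cusum_step mu n k Delta u : (0 < k <= n)%N ->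
    (forall i, L2 (mu i)) -> L2 Delta -> L2 u ->
    (forall i, (1 <= i <= k)%N -> {ae leb01, forall t, mu i t = mu 1%N t}) ->
    (forall i, (k < i <= n)%N -> {ae leb01, forall t, mu i t = mu n t}) ->
    {ae leb01, forall t, mu n t - mu 1%N t = Delta t} ->
  l2dot (cusum n k mu) u = - (k%:R * (n%:R - k%:R) / n%:R) * l2dot Delta u.
Proof.
move=> kn Lmu LD Lu mu1 mu2 muD.
rewrite -l2dotZl//; apply: ae_eq_l2dotl => //; [exact: L2_cusum|exact: L2Z|].
have ae_imp (b : bool) (Q : R -> Prop) : (b -> {ae leb01, forall t, Q t}) ->
    {ae leb01, forall t, b -> Q t}.
  case: b => [/(_ isT) hQ|_]; first by apply: filterS hQ => t.
  exact: nearW.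
have {}mu1 : {ae leb01, forall t,
    forall i, (1 <= i <= k)%N -> mu i t = mu 1%N t}.
  by apply: (ae_foralln (mu := leb01)) => i; exact: ae_imp (mu1 i).
have {}mu2 : {ae leb01, forall t,
    forall i, (k < i <= n)%N -> mu i t = mu n t}.
  by apply: (ae_foralln (mu := leb01)) => i; exact: ae_imp (mu2 i).
apply: filterS3 mu1 mu2 muD => t h1 h2 <-.
exact: cusum_step.
Qed.

(** Multiplying by [sqrt n] clears the normalization of [eta]: the left-hand
    side is the drift, of order [n], minus the two noise terms. *)
Lemma eta_change_lower n k (r : nat) (mu Z u : nat -> R -> R) Delta :
    (0 < k <= n)%N ->
    (forall i, L2 (mu i)) -> (forall i, L2 (Z i)) -> L2 Delta ->
    (forall i, (1 <= i <= k)%N -> {ae leb01, forall t, mu i t = mu 1%N t}) ->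
    (forall i, (k < i <= n)%N -> {ae leb01, forall t, mu i t = mu n t}) ->
    {ae leb01, forall t, mu n t - mu 1%N t = Delta t} ->
    orthonormal2 u ->
  k%:R * (n%:R - k%:R) / n%:R * `|l2dot Delta (u r)|
    - l2norm (psum Z k) - k%:R / n%:R * l2norm (psum Z n)
  <= Num.sqrt n%:R * `|Defs.eta n k r (fun i t => mu i t + Z i t) u|.
Proof.
move=> /andP[k0 kn] Lmu LZ LD mu1 mu2 muD [Lu u1].
have n0 : 0 < n%:R :> R by rewrite ltr0n (leq_trans k0).
rewrite etaE normrM ger0_norm ?invr_ge0 ?sqrtr_ge0// mulVKf; last first.
  by rewrite gt_eqF// sqrtr_gt0.
rewrite cusumD l2dotDl//; [|exact: L2_cusum|exact: L2_cusum].
have := ler_norm_l2dot_cusum n k LZ (Lu r).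
rewrite l2normE u1 eqxx sqrtr1 => /(_ erefl) noise.
rewrite (l2dot_cusum_step _ Lmu LD (Lu r) mu1 mu2 muD) ?k0//.
have a0 : 0 <= k%:R * (n%:R - k%:R) / n%:R :> R.
  by rewrite divr_ge0// mulr_ge0// subr_ge0 ler_nat.
rewrite -{1}(ger0_norm a0) -normrM -normrN -mulNr.
set x := _ * l2dot Delta _; set y := l2dot (cusum _ _ _) _ in noise *.
have := lerB_normD x y.
by lra.
Qed.

End cusum_theory.

(** * Lower bound for the statistic *)

(** Every weight is at least [1], so one coordinate at one time suffices.  The
    hypothesis is multiplied out by [l r] so as to cover uniformly the case
    [l r = 0], in which the statistic is infinite by convention. *)
Lemma Tstat_gt (R : realType) d n k (r : 'I_d) (Z u : nat -> R -> R)
    (l : nat -> R) (c : R) :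
    (0 < k < n)%N -> (forall i, 0 <= l i) -> 0 <= c ->
    c ^+ 2 * l r < Defs.eta n k r Z u ^+ 2 ->
  (c%:E < Tstat d n Z u l)%E.
Proof.
move=> /andP[k0 kn] l0 c0 cl; rewrite /Tstat.
case: ifPn => [_|/existsPn l_neq0]; first by rewrite ltry.
have lr : 0 < l r by rewrite lt_def l_neq0 l0.
rewrite lte_fin.
pose F j := weight (j%:R / n%:R) *
  Num.sqrt (\sum_(i < d) Defs.eta n j i Z u ^+ 2 / l i).
have FM : F k <= \big[Num.max/0]_(1 <= j < n) F j.
  by apply: le_bigmax_seq => //; rewrite mem_index_iota k0.
apply: lt_le_trans _ FM.
have n0 : (0 < n)%N by exact: ltn_trans kn.
pose x : R := k%:R / n%:R.
have [x0 x1] : 0 < x /\ x < 1.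
  by rewrite divr_gt0 ?ltr0n// ltr_pdivrMr ?ltr0n// mul1r ltr_nat.
have w1 : 1 <= weight x.
  rewrite /weight -[leLHS]invr1 lef_pV2 ?posrE ?sqrtr_gt0//; last by nra.
  by rewrite -[leRHS]sqrtr1 ler_wsqrtr//; nra.
rewrite /F; apply: lt_le_trans _ (ler_wpM2r (sqrtr_ge0 _) w1); rewrite mul1r.
have sum_ge : Defs.eta n k r Z u ^+ 2 / l r <=
    \sum_(i < d) Defs.eta n k i Z u ^+ 2 / l i.
  rewrite (bigD1 r)//= lerDl sumr_ge0// => i _.
  by rewrite divr_ge0 ?sqr_ge0.
apply: lt_le_trans _ (ler_wsqrtr sum_ge).
rewrite -[ltLHS]ger0_norm// -sqrtr_sqr ltr_sqrt.
  by rewrite ltr_pdivlMr.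
rewrite divr_gt0//; apply: le_lt_trans cl.
by rewrite mulr_ge0// sqr_ge0.
Qed.

(** The arithmetic that balances the thresholds of the four good events.  The
    drift per observation is at least [(1 - theta) xi / 2]; allowing each noise
    term [(1 - theta) xi / 8] leaves half of it, and [k >= n theta / 2] then
    yields [eta ^ 2 >= n c ^ 2] with [c = theta (1 - theta) xi / 8].  The
    threshold on [l] is chosen with [M ^ 2 + 1] rather than [M ^ 2] to make the
    conclusion strict and the quotient meaningful for every [M]. *)
Lemma sqr_drift_gt (R : realType) (n k theta xi D Sk Sn l LL M E : R) :
    0 < n -> 0 < theta -> theta < 1 -> 0 < xi -> 0 < LL ->
    n * theta <= 2 * k -> k <= n * theta ->
    xi / 2 <= D -> Sk <= (1 - theta) * xi / 8 * k ->
    Sn <= (1 - theta) * xi / 8 * n ->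
    l <= (theta * (1 - theta) * xi / 8) ^+ 2 / (M ^+ 2 + 1) * (n / LL) ->
    k * (n - k) / n * D - Sk - k / n * Sn <= Num.sqrt n * `|E| ->
  (M * Num.sqrt LL) ^+ 2 * l < E ^+ 2.
Proof.
move=> n0 t0 t1 xi0 LL0 kl ku hD hSk hSn hl hE.
set c := theta * (1 - theta) * xi / 8 in hl.
have c0 : 0 < c by rewrite /c !mulr_gt0 ?subr_gt0// invr_gt0.
have k0 : 0 < k.
  rewrite -(pmulr_rgt0 _ (ltr0n R 2)); apply: lt_le_trans kl.
  exact: mulr_gt0.
have nc : n * c <= k * (n - k) / n * D - Sk - k / n * Sn.
  have h1 : (1 - theta) * (xi / 2) <= (n - k) / n * D.
    apply: ler_pM => //; [lra|lra|].
    by rewrite ler_pdivlMr//; nra.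
  have h2 : Sn / n <= (1 - theta) * xi / 8 by rewrite ler_pdivrMr.
  have -> : k * (n - k) / n * D - Sk - k / n * Sn =
            k * ((n - k) / n * D - Sn / n) - Sk by field; rewrite gt_eqF.
  have h3 : k * ((1 - theta) * (xi / 2) - (1 - theta) * xi / 8) <=
            k * ((n - k) / n * D - Sn / n) by rewrite ler_pM2l//; lra.
  have h4 : n * theta * ((1 - theta) * xi / 8) <=
            2 * k * ((1 - theta) * xi / 8).
    by rewrite ler_pM2r// divr_gt0// mulr_gt0// subr_gt0.
  by rewrite /c; lra.
have E2 : n * c ^+ 2 <= E ^+ 2.
  have ncE := le_trans nc hE.
  have nc0 : 0 <= n * c by rewrite mulr_ge0// ltW.
  have : (n * c) ^+ 2 <= (Num.sqrt n * `|E|) ^+ 2.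
    by rewrite ler_sqr ?nnegrE// (le_trans nc0 ncE).
  rewrite [(n * c) ^+ 2]exprMn [(_ * `|E|) ^+ 2]exprMn sqr_sqrtr ?(ltW n0)//.
  rewrite real_normK ?num_real//.
  by rewrite expr2 -mulrA ler_pM2l.
apply: lt_le_trans E2.
rewrite exprMn sqr_sqrtr ?(ltW LL0)//.
have ML0 : 0 <= M ^+ 2 * LL by rewrite mulr_ge0 ?sqr_ge0// ltW.
apply: le_lt_trans (ler_wpM2l ML0 hl) _.
have M1 : 0 < M ^+ 2 + 1 by rewrite ltr_wpDl ?sqr_ge0.
have -> : M ^+ 2 * LL * (c ^+ 2 / (M ^+ 2 + 1) * (n / LL)) =
          n * c ^+ 2 * (M ^+ 2 / (M ^+ 2 + 1)).
  by field; rewrite !gt_eqF.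
rewrite gtr_pMr; last by apply: mulr_gt0 => //; exact: exprn_gt0.
by rewrite ltr_pdivrMr// mul1r ltrDl.
Qed.

(** * Measurability *)

Section measurability.
Context {R : realType} {disp : measure_display} {T : measurableType disp}.
Implicit Types (Z W : T -> R -> R).

(** The positive and negative parts are treated separately, since Tonelli's
    theorem gives the measurability of the parametric integral of a nonnegative
    function without integrability. *)
Lemma measurable_Rintegral_leb01 (h : measurableTypeR R * T -> R) :
  measurable_fun setT h ->
  measurable_fun setT (fun w => \int[leb01]_t h (t, w)).
Proof.
move=> mh.
pose G w : \bar R := (\int[leb01]_t (h (t, w))%:E)%E.
suff mG : measurable_fun setT G.
  exact: (measurableT_comp (fine_measurable measurableT) mG).
rewrite (_ : G = (fun w => (\int[leb01]_t funepos (EFin \o h) (t, w))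
    - (\int[leb01]_t funeneg (EFin \o h) (t, w)))%E); last first.
  apply/funext => w; rewrite /G integralE.
  by congr (_ - _)%E; apply: eq_integral => t _; rewrite ?funeposE ?funenegE.
have mEh : measurable_fun setT (EFin \o h) by exact/measurable_EFinP.
have mpart (g : measurableTypeR R * T -> \bar R) : measurable_fun setT g ->
    (forall x, 0 <= g x)%E ->
    measurable_fun setT (fun w => \int[leb01]_t g (t, w))%E.
  exact: (measurable_fun_fubini_tonelli_G (m1 := leb01)).
apply: emeasurable_funB; apply: mpart => //.
- exact: measurable_funepos.
- exact: measurable_funeneg.
Qed.

Lemma random_L2_cst (f : R -> R) : L2 f -> random_L2 (fun _ : T => f).
Proof.
move=> Lf; split=> //.
exact: (measurableT_comp (L2_measurable Lf) measurable_fst).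
Qed.

Lemma random_L2D Z W : random_L2 Z -> random_L2 W ->
  random_L2 (fun w t => Z w t + W w t).
Proof.
move=> [mZ LZ] [mW LW]; split=> [|w]; last exact: L2D.
exact: measurable_funD.
Qed.

Lemma random_L2Z (a : R) Z : random_L2 Z -> random_L2 (fun w t => a * Z w t).
Proof.
move=> [mZ LZ]; split=> [|w]; last exact: L2Z.
exact: measurable_funM.
Qed.

Lemma random_L2_sum I (s : seq I) (Z : I -> T -> R -> R) :
  (forall i, random_L2 (Z i)) ->
  random_L2 (fun w t => \sum_(i <- s) Z i w t).
Proof.
move=> hZ; split=> [|w]; last by apply: L2_sum => i; exact: (hZ i).2.
by apply: measurable_sum => i; exact: (hZ i).1.
Qed.

Lemma measurable_l2dot Z W : random_L2 Z -> random_L2 W ->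
  measurable_fun setT (fun w => l2dot (Z w) (W w)).
Proof.
move=> [mZ _] [mW _].
exact: (measurable_Rintegral_leb01 (measurable_funM mZ mW)).
Qed.

Lemma measurable_sqrtr (f : T -> R) : measurable_fun setT f ->
  measurable_fun setT (fun w => Num.sqrt (f w)).
Proof.
move=> mf.
exact: (measurableT_comp (continuous_measurable_fun (@sqrt_continuous R)) mf).
Qed.

Lemma measurable_l2norm Z : random_L2 Z ->
  measurable_fun setT (fun w => l2norm (Z w)).
Proof.
move=> hZ; under eq_fun do rewrite l2normE.
exact/measurable_sqrtr/measurable_l2dot.
Qed.

(** The scalings are nonnegative, so that their inverses are the powers of
    exponent [-1], which are measurable; zero is sent to zero by both. *)
Lemma measurable_Tstat d n (Z u : nat -> T -> R -> R) (l : nat -> T -> R) :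
    (forall i, random_L2 (Z i)) -> (forall i, random_L2 (u i)) ->
    (forall i, measurable_fun setT (l i)) -> (forall i w, 0 <= l i w) ->
  measurable_fun setT (fun w => Tstat d n (fun i => Z i w) (fun i => u i w)
                                  (fun i => l i w)).
Proof.
move=> hZ hu ml l0.
have mE k r : measurable_fun setT
    (fun w => Defs.eta n k r (fun i => Z i w) (fun i => u i w)).
  under eq_fun do rewrite etaE.
  apply: measurable_funM => //; apply: measurable_l2dot => //.
  by apply: random_L2D; [|apply: random_L2Z]; exact: random_L2_sum.
have mlV i : measurable_fun setT (fun w => (l i w)^-1).
  under eq_fun do rewrite -powR_inv1//.
  exact: (measurableT_comp (measurable_powR (-1)) (ml i)).
apply: measurable_fun_ifT => //.
- rewrite (_ : (fun w => _) =
      (fun w => \big[orb/false]_(r < d) (l r w == 0))); last first.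
    by apply/funext => w; rewrite big_orE.
  elim: (index_enum _) => [|r s IHs].
    by under eq_fun do rewrite big_nil; exact: measurable_cst.
  under eq_fun do rewrite big_cons.
  apply: measurable_or => //; exact: measurable_fun_eqr.
- apply/measurable_EFinP.
  elim: (index_iota _ _) => [|k s IHs].
    by under eq_fun do rewrite big_nil; exact: measurable_cst.
  under eq_fun do rewrite big_cons.
  apply: measurable_maxr => //.
  apply: measurable_funM => //; apply: measurable_sqrtr.
  apply: measurable_sum => r; apply: measurable_funM => //.
  exact: measurable_funX.
Qed.

Lemma measurable_dev (f : T -> R) (c e : R) : measurable_fun setT f ->
  measurable [set w | e < `|f w - c|].
Proof.
move=> mf.
have mg : measurable_fun setT (fun w => `|f w - c|).
  by apply: measurableT_comp => //; exact: measurable_funB.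
have := mg measurableT _ (measurable_itv `]e, +oo[).
rewrite setTI; congr measurable.
by apply/seteqP; split=> w /=; rewrite in_itv/= andbT.
Qed.

End measurability.

(** * Convergence in probability and asymptotics in the sample size *)

Section convergence.
Context {R : realType} {disp : measure_display} {T : measurableType disp}.
Context (P : probability T R).

Lemma cvg_probU (A B : nat -> set T) :
    (forall n, measurable (A n)) -> (forall n, measurable (B n)) ->
    P (A n) @[n --> \oo] --> 0%E -> P (B n) @[n --> \oo] --> 0%E ->
  P (A n `|` B n) @[n --> \oo] --> 0%E.
Proof.
move=> mA mB A0 B0.
apply: (squeeze_cvge (f := cst 0%E) (h := fun n => (P (A n) + P (B n))%E)).
- by apply: nearW => n; rewrite measure_ge0 measureU2.
- exact: cvg_cst.
- by rewrite -[X in _ --> X]adde0; apply: cvgeD.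
Qed.

(** Reduces convergence of probabilities to [1] to a cover of the complements by
    exceptional events whose probabilities tend to [0]. *)
Lemma cvg_prob_compl_sub (A B : nat -> set T) :
    (forall n, measurable (A n)) -> (forall n, measurable (B n)) ->
    (\forall n \near \oo, ~` A n `<=` B n) ->
    P (B n) @[n --> \oo] --> 0%E ->
  P (A n) @[n --> \oo] --> 1%E.
Proof.
move=> mA mB AB B0.
apply: (squeeze_cvge (f := fun n => (1 - P (B n))%E) (h := cst 1%E)).
- near=> n; rewrite probability_le1// andbT -probability_setC//.
  apply: le_measure; rewrite ?inE//; first exact: measurableC.
  by rewrite -[A n]setCK; apply: subsetC; near: n.
- rewrite -[X in _ --> X]sube0; apply: cvgeB => //; exact: cvg_cst.
- exact: cvg_cst.
Unshelve. all: by end_near. Qed.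

End convergence.

Lemma near_lnln_gt0 (R : realType) : \forall n \near \oo, 0 < ln (ln n%:R : R).
Proof.
near=> n.
have en : expR 1 < n%:R :> R by near: n; exact: nbhs_infty_gtr.
have n0 : 0 < n%:R :> R by apply: lt_trans en; exact: expR_gt0.
by apply: ln_gt0; rewrite -ltr_expR lnK.
Unshelve. all: by end_near. Qed.

Lemma near_truncn_scale (R : realType) (theta : R) (N : nat) : 0 < theta ->
  \forall n \near \oo, (N <= Num.truncn (n%:R * theta))%N.
Proof.
move=> t0; near=> n.
have Nn : N%:R / theta < n%:R by near: n; exact: nbhs_infty_gtr.
have /andP[_] := truncn_itv (mulr_ge0 (ler0n R n) (ltW t0)).
rewrite ltr_pdivrMr// in Nn.
by move=> /(lt_trans Nn); rewrite ltr_nat ltnS.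
Unshelve. all: by end_near. Qed.

(** * Consistency of the test *)

Theorem theorem3p7 (R : realType) (disp : measure_display)
  (T : measurableType disp) (P : probability T R)
  (Y : int -> T -> R -> R) (nu : R)
  (Y_L2 : forall i, random_L2 (Y i))
  (Y_centered : centered P Y)
  (Y_stationary : strictly_stationary P Y)
  (nu_gt2 : 2 < nu)
  (Y_moment : ('E_P[fun w => (l2norm (Y 1 w) `^ nu)%R] < +oo)%E)
  (theta : R) (Delta : R -> R) (mu : nat -> nat -> R -> R)
  (zeta : R * R -> R) (lambda : nat -> R) (v : nat -> R -> R)
  (lambdah : nat -> nat -> T -> R) (vh : nat -> nat -> T -> R -> R)
  (lambdah_rv : forall n r, measurable_fun [set: T] (lambdah n r))
  (lambdah_dec : forall n r w, 0 <= lambdah n r.+1 w <= lambdah n r w)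
  (vh_L2 : forall n r, random_L2 (vh n r))
  (vh_orth : forall n w, orthonormal2 (fun r => vh n r w))
  (d : nat) (d_gt0 : (0 < d)%N)
  (zeta_L2 : L2sq zeta)
  (zeta_lrc : is_long_run_cov P Y zeta)
  (eig : eigen_system zeta lambda v)
  (lambda_d : 0 < lambda d.-1)
  (L : forall x : R,
    P [set w | ((a_norm (ln n%:R))%:E
                  * Tstat d n (fun i => Y i%:Z w) v lambda
                - (b_norm d (ln n%:R))%:E <= x%:E)%E] @[n --> \oo]
      --> (expR (- 2 * expR (- x)))%:E)
  (P2 : little_oP P
    (fun n w => l2norm (fun t => \sum_(1 <= i < n.+1) Y i%:Z w t))
    (fun n => n%:R))
  (HA : H_A theta Delta mu)
  (B1 : little_oP P (fun n w => lambdah n 0%N w)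
    (fun n => n%:R / ln (ln n%:R)))
  (B2 : exists (r : 'I_d) (xi : R), 0 < xi /\
    cvg_prob P (fun n w => `|\int[leb01]_t (Delta t * vh n r w t)|) xi) :
  cvg_prob_pinfty P (fun n w =>
    ((Num.sqrt (ln (ln n%:R)))^-1)%:E
    * Tstat d n (fun i => observation mu Y n i w)
        (fun r => vh n r w) (fun r => lambdah n r w))%E.
Proof.
move=> M.
have [/andP[t0 t1] LD _ Lmu Hmu] := HA.
have [r [xi [xi0 cvD]]] := B2.
pose YS i w := Y i%:Z w.
have hYS (i : nat) : random_L2 (YS i) by exact: Y_L2.
have hS k : random_L2 (fun w => psum (fun i => YS i w) k).
  exact: random_L2_sum.
have lh0 n i w : 0 <= lambdah n i w.
  by have /andP[h] := lambdah_dec n i w; exact: le_trans.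
have lh_le n i w : lambdah n i w <= lambdah n 0%N w.
  elim: i => // i IHi; apply: le_trans IHi.
  by case/andP: (lambdah_dec n i w).
pose k n := Num.truncn (n%:R * theta).
pose del := (1 - theta) * xi / 8.
have del0 : 0 < del by rewrite divr_gt0// mulr_gt0// subr_gt0.
pose ep := (theta * (1 - theta) * xi / 8) ^+ 2 / (`|M| ^+ 2 + 1).
have ep0 : 0 < ep.
  by rewrite divr_gt0 ?exprn_gt0 ?divr_gt0 ?mulr_gt0 ?subr_gt0//
    ltr_wpDl ?sqr_ge0.
(* The exceptional events: too large a noise at time n, too large a noise at
   the time of change, too large a first eigenvalue, and a projection of the
   change too far from its limit.  The thresholds are those of
   [sqr_drift_gt]. *)
pose A1 n := [set w | del < `|l2norm (psum (fun i => YS i w) n) / n%:R - 0|].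
pose A2 n := A1 (k n).
pose A3 n := [set w | ep < `|lambdah n 0%N w / (n%:R / ln (ln n%:R)) - 0|].
pose A4 n := [set w | xi / 2 < `| `|l2dot Delta (vh n r w)| - xi|].
have mA1 n : measurable (A1 n).
  apply: measurable_dev; apply: measurable_funM => //; exact: measurable_l2norm.
have mA2 n : measurable (A2 n) by exact: mA1.
have mA3 n : measurable (A3 n).
  by apply: measurable_dev; apply: measurable_funM.
have mA4 n : measurable (A4 n).
  apply: measurable_dev; apply: measurableT_comp => //.
  by apply: measurable_l2dot => //; exact: random_L2_cst.
have cA1 : P (A1 n) @[n --> \oo] --> 0%E by exact: P2.
have cA2 : P (A2 n) @[n --> \oo] --> 0%E.
  (* The assumption on the errors, along the subsequence of times of change. *)
  apply: cvg_comp cA1.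
  by apply/cvgnyPge => N; exact: near_truncn_scale.
have cA3 : P (A3 n) @[n --> \oo] --> 0%E by exact: B1.
have cA4 : P (A4 n) @[n --> \oo] --> 0%E by apply: cvD; rewrite divr_gt0.
apply: (cvg_prob_compl_sub (B := fun n => (A1 n `|` A2 n) `|` (A3 n `|` A4 n))).
- move=> n.
  have mT : measurable_fun setT (fun w => ((Num.sqrt (ln (ln n%:R)))^-1)%:E
      * Tstat d n (fun i => observation mu Y n i w)
          (fun r => vh n r w) (fun r => lambdah n r w))%E.
    apply: emeasurable_funM; first exact: measurable_cst.
    apply: measurable_Tstat => // i.
    by apply: random_L2D; [exact: random_L2_cst|exact: Y_L2].
  have := emeasurable_fun_o_infty measurableT mT M%:E.
  by rewrite setTI.
- by move=> n; apply: measurableU; apply: measurableU.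
- near=> n => w /= TM.
  apply: contrapT => /not_orP[/not_orP[nA1 nA2] /not_orP[nA3 nA4]].
  apply: TM.
  have n0 : (0 < n)%N by near: n; exists 1%N.
  have n0R : 0 < n%:R :> R by rewrite ltr0n.
  have kge1 : (0 < k n)%N by near: n; exact: near_truncn_scale.
  have LL0 : 0 < ln (ln n%:R : R) by near: n; exact: near_lnln_gt0.
  have /andP[kle klt] := truncn_itv (mulr_ge0 (ler0n R n) (ltW t0)).
  rewrite -/(k n) in kle klt.
  have kn : (k n < n)%N.
    by rewrite -(ltr_nat R); apply: le_lt_trans kle _; rewrite gtr_pMr.
  have k0R : 0 < (k n)%:R :> R by rewrite ltr0n.
  have [mu1 mu2 muD] := Hmu n kge1.
  have := eta_change_lower r (u := fun r => vh n r w) _ (Lmu n)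
    (fun i => (hYS i).2 w) LD mu1 mu2 muD (vh_orth n w).
  rewrite kge1 (ltnW kn) => /(_ isT) eta_ge.
  rewrite lte_pdivlMl ?sqrtr_gt0//.
  apply: (@le_lt_trans _ _ (`|M| * Num.sqrt (ln (ln n%:R)))%:E).
    by rewrite -EFinM lee_fin mulrC ler_wpM2r ?sqrtr_ge0// ler_norm.
  apply: (Tstat_gt (k := k n) (r := r)) => //; first by rewrite kge1.
  apply: (sqr_drift_gt (theta := theta) (xi := xi)
    _ _ _ _ _ _ _ _ _ _ _ eta_ge) => //.
  (* n theta < k + 1 <= 2 k, as k is positive. *)
  + rewrite -natr1 in klt.
    have k1 : 1 <= (k n)%:R :> R by rewrite ler1n.
    by lra.
  + by move/negP: nA4; rewrite -leNgt ler_norml => /andP[+ _]; lra.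
  + rewrite -ler_pdivrMr//; apply: le_trans (ler_norm _) _.
    by move/negP: nA2; rewrite -leNgt subr0.
  + rewrite -ler_pdivrMr//; apply: le_trans (ler_norm _) _.
    by move/negP: nA1; rewrite -leNgt subr0.
  + apply: le_trans (lh_le _ _ _) _.
    rewrite -ler_pdivrMr ?divr_gt0//; apply: le_trans (ler_norm _) _.
    by move/negP: nA3; rewrite -leNgt subr0.
- apply: cvg_probU; [by move=> n; exact: measurableU|
    by move=> n; exact: measurableU|exact: cvg_probU|exact: cvg_probU].
Unshelve. all: by end_near. Qed.
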